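(* Let $p\ge3$. For every $n\ge1$, there is a bijection between the intervals of $\mathbb{F}_n^p$ and the bicolored Motzkin paths of length $n-1$ avoiding all $2^{p+1}-1$ patterns in the set $\{F_2,U\}^p\cup\{F_2,D\}^p$ (i.e. all words of length $p$ over $\{F_2,U\}$ and all words of length $p$ over $\{F_2,D\}$).
   Context: A Dyck path of semilength $n\ge 0$ is a lattice path from $(0,0)$ to $(2n,0)$ with steps $U=(1,1)$ and $D=(1,-1)$ that never goes below the $x$-axis; it is identified with its word over $\{U,D\}$. A path (or word) avoids a pattern $\alpha$ if $\alpha$ does not occur as a factor (block of consecutive steps). For an integer $p\ge 2$, $\mathcal{F}_n^p$ is the set of Dyck paths of semilength $n$ avoiding $DUU$ and $D^{p+1}$, ordered by the Stanley order: $P\le Q$ iff $P$ lies weakly below $Q$ when both are drawn in the plane; $\mathbb{F}_n^p=(\mathcal{F}_n^p,\le)$. An interval is a set $[P,Q]=\{R:P\le R\le Q\}$ with $P\le Q$. A bicolored Motzkin path of length $m$ is a lattice path in the quarter plane $\{y\ge0\}$ starting at $(0,0)$, consisting of $m$ steps each among $U=(1,1)$, $D=(1,-1)$, $F_1=(1,0)$, $F_2=(1,0)$ (two distinguishable kinds of flat steps), with arbitrary endpoint height; it is identified with its word over $\{U,D,F_1,F_2\}$. *)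

(* Defs.v *)
From HB Require Import structures.
From mathcomp Require Import all_boot all_order all_algebra.

Set Implicit Arguments.
Unset Strict Implicit.
Unset Printing Implicit Defensive.

Import Order.TTheory GRing.Theory Num.Theory.

Local Open Scope ring_scope.

Definition avoids (T : eqType) (a w : seq T) : bool := ~~ infix a w.

Inductive dstep := dU | dD.

Definition bool_of_dstep (s : dstep) : bool := if s is dU then true else false.
Definition dstep_of_bool (b : bool) : dstep := if b then dU else dD.

Lemma bool_of_dstepK : cancel bool_of_dstep dstep_of_bool.
Proof. by case. Qed.

HB.instance Definition _ := Finite.copy dstep (can_type bool_of_dstepK).

Definition drise (s : dstep) : int := match s with dU => 1 | dD => - 1 end.

Definition dheight (w : seq dstep) (i : nat) : int :=
  \sum_(s <- take i w) drise s.

Definition is_dyck (n : nat) (w : seq dstep) : bool :=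
  [&& size w == n.*2,
      [forall i : 'I_(n.*2).+1, 0 <= dheight w i]
    & dheight w n.*2 == 0].

Record dyck (n : nat) :=
  Dyck { dword :> (n.*2).-tuple dstep; _ : is_dyck n dword }.

HB.instance Definition _ n := [isSub for @dword n].
HB.instance Definition _ n := [Finite of dyck n by <:].

(* Both paths are affine between consecutive integer abscissae, so lying weakly
   below is tested at these abscissae only. *)
Definition stanley_le (n : nat) (P Q : dyck n) : bool :=
  [forall i : 'I_(n.*2).+1, dheight P i <= dheight Q i].

Lemma stanley_le_refl n : reflexive (@stanley_le n).
Proof. by move=> P; apply/forallP. Qed.

Lemma stanley_le_trans n : transitive (@stanley_le n).
Proof.
move=> Q P S /forallP PQ /forallP QS; apply/forallP => i.
exact: le_trans (PQ i) (QS i).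
Qed.

Lemma dheightS (w : seq dstep) i :
  (i < size w)%N -> dheight w i.+1 = dheight w i + drise (nth dU w i).
Proof. by move=> iw; rewrite /dheight (take_nth dU iw) big_rcons. Qed.

Lemma drise_inj : injective drise.
Proof. by case; case. Qed.

Lemma stanley_le_anti n : antisymmetric (@stanley_le n).
Proof.
move=> P Q /andP[/forallP PQ /forallP QP].
have E i : (i <= n.*2)%N -> dheight P i = dheight Q i.
  rewrite -ltnS => lti; apply: le_anti.
  by rewrite (PQ (Ordinal lti)) (QP (Ordinal lti)).
apply/val_inj/val_inj/(@eq_from_nth _ dU); rewrite !size_tuple // => i lti.
apply: drise_inj; apply: (addrI (dheight P i)).
by rewrite {2}E ?(ltnW lti) // -!dheightS ?size_tuple // E.
Qed.

Fact stanley_display : Order.disp_t. Proof. exact: (Order.Disp tt tt). Qed.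

HB.instance Definition _ n :=
  Order.Le_isPOrder.Build stanley_display (dyck n)
    (@stanley_le_refl n) (@stanley_le_anti n) (@stanley_le_trans n).

Definition is_fdyck (p n : nat) (P : dyck n) : bool :=
  avoids [:: dD; dU; dU] P && avoids (nseq p.+1 dD) P.

Record fdyck (p n : nat) := FDyck { fpath :> dyck n; _ : is_fdyck p fpath }.

HB.instance Definition _ p n := [isSub for @fpath p n].
HB.instance Definition _ p n := [Finite of fdyck p n by <:].
HB.instance Definition _ p n :=
  [SubChoice_isSubPOrder of fdyck p n by <: with stanley_display].

Definition poset_itv (d : Order.disp_t) (T : finPOrderType d) (P Q : T) :
    {set T} :=
  [set R | (P <= R <= Q)%O].

Definition intervals (d : Order.disp_t) (T : finPOrderType d) :
    {set {set T}} :=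
  [set I | [exists P : T, exists Q : T, (P <= Q)%O && (I == poset_itv P Q)]].

Inductive mstep := mU | mD | mF1 | mF2.

Definition boolp_of_mstep (s : mstep) : bool * bool :=
  match s with
  | mU => (true, true)
  | mD => (true, false)
  | mF1 => (false, true)
  | mF2 => (false, false)
  end.

Definition mstep_of_boolp (b : bool * bool) : mstep :=
  match b with
  | (true, true) => mU
  | (true, false) => mD
  | (false, true) => mF1
  | (false, false) => mF2
  end.

Lemma boolp_of_mstepK : cancel boolp_of_mstep mstep_of_boolp.
Proof. by case. Qed.

HB.instance Definition _ := Finite.copy mstep (can_type boolp_of_mstepK).

Definition mrise (s : mstep) : int :=
  match s with mU => 1 | mD => - 1 | mF1 | mF2 => 0 end.

Definition mheight (w : seq mstep) (i : nat) : int :=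
  \sum_(s <- take i w) mrise s.

(* The final height is unconstrained. *)
Definition is_motzkin (m : nat) (w : seq mstep) : bool :=
  (size w == m) && [forall i : 'I_m.+1, 0 <= mheight w i].

Definition mpatterns (p : nat) : {set p.-tuple mstep} :=
  [set a : p.-tuple mstep | all (mem [:: mF2; mU]) a] :|:
  [set a : p.-tuple mstep | all (mem [:: mF2; mD]) a].

Definition avoiding_motzkin (p m : nat) : {set m.-tuple mstep} :=
  [set w : m.-tuple mstep |
    is_motzkin m w && [forall a in mpatterns p, avoids (tval a) w]].

(* Main.v *)
(* A Dyck path avoiding DUU has the form U^k D e_1 D e_2 ... D e_(n-1) D with each
   e_i empty or equal to U, and k is forced by the semilength n; every such word is
   a Dyck path.  Hence the path is encoded by the bits (e_i = U), and it avoids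
   D^(p+1) iff the bit word avoids 0^p.  Reading the bits from the right, P <= Q in
   the Stanley order iff every prefix of the bits of P has at least as many ones as
   the corresponding prefix of the bits of Q.  Superposing the two bit words of an
   interval letter by letter, with (1,0) = U, (0,1) = D, (1,1) = F1 and (0,0) = F2,
   dominance becomes nonnegativity of the heights, the avoidance of 0^p by the bits
   of P becomes that of {F2,D}^p, and the avoidance by those of Q that of {F2,U}^p. *)
Require Import Defs.
From HB Require Import structures.
From mathcomp Require Import all_boot all_order all_algebra.
From mathcomp Require Import zify.

Set Implicit Arguments.
Unset Strict Implicit.
Unset Printing Implicit Defensive.

Import Order.TTheory GRing.Theory Num.Theory.

(** * Reversed paths: counts of D's and heights *)

(* The path U^k D e_1 ... D e_m D written backwards; [s] lists the bits of e_m, ..., e_1. *)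
Fixpoint revpath (k : nat) (s : seq bool) : seq dstep :=
  match s with
  | [::] => dD :: nseq k dU
  | true :: s' => [:: dD, dU & revpath k s']
  | false :: s' => dD :: revpath k s'
  end.

Notation ones s := (count id s).
Notation downs w := (count_mem dD w).

Lemma downs_revpath k s : downs (revpath k s) = (size s).+1.
Proof. by elim: s => [|[] s IH] /=; rewrite ?count_nseq ?IH //. Qed.

Lemma size_revpath k s : size (revpath k s) = (size s + ones s + k).+1.
Proof. by elim: s => [|[] s IH] /=; rewrite ?size_nseq ?IH //; lia. Qed.

Lemma leq_count_take (T : Type) (a : pred T) s i j :
  i <= j -> count a (take i s) <= count a (take j s).
Proof.
by move=> ij; rewrite -(subnKC ij) takeD count_cat leq_addr.
Qed.

Lemma count_take_leq (T : Type) (a : pred T) i s :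
  count a (take i s) <= count a s.
Proof. by rewrite -[X in _ <= count a X](cat_take_drop i) count_cat leq_addr. Qed.

(** The D with index [j] is preceded by [j] other D's and by one U for each true bit among the first
    [j]. *)
Lemma downs_take_revpath k s j : j <= size s ->
  downs (take (j + ones (take j s)) (revpath k s)) = j /\
  downs (take (j + ones (take j s)).+1 (revpath k s)) = j.+1.
Proof.
elim: s j => [|b s IH] [|j] //=; first by case: k.
  by case: b => /=; case: (revpath k s).
rewrite ltnS => /IH [E1 E2].
by case: b => /=; rewrite ?add1n ?add0n ?addnS ?addSn /= ?E1 ?E2.
Qed.

(* Just before its (m+1)-st D the reversed path has seen exactly [ones (take m s)] letters U;
   this Galois connection lets [dominance_revpath] compare paths of different shapes. *)
Lemma downs_take_revpath_leq k s i m : m <= size s ->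
  (downs (take i (revpath k s)) <= m) = (i <= m + ones (take m s)).
Proof.
move=> /(downs_take_revpath k)[E1 E2]; apply/idP/idP => [|le_i].
  by apply: contraLR; rewrite -!ltnNge -{1}E2; apply: leq_count_take.
by apply: leq_trans (leq_count_take _ _ le_i) _; rewrite E1.
Qed.

Lemma dominance_revpath k l s t : size s = size t ->
  (forall i, downs (take i (revpath k s)) <= downs (take i (revpath l t))) <->
  (forall j, ones (take j t) <= ones (take j s)).
Proof.
move=> eq_sz; split=> [le_st j | le_ts i].
  wlog: j / j <= size s => [IH|le_j].
    case: (leqP j (size s)) => [/IH//|lt_j].
    have := IH _ (leqnn _).
    by rewrite {1}eq_sz !take_size !take_oversize // -?eq_sz ltnW.
  (* The hypothesis is tested at the position of the D with index [j] in the path of [t]. *)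
  rewrite -(leq_add2l j) -(downs_take_revpath_leq k) //.
  by rewrite (leq_trans (le_st _)) // downs_take_revpath_leq -?eq_sz.
set m := downs (take i (revpath l t)).
case: (leqP m (size s)) => [le_m|lt_m].
  rewrite downs_take_revpath_leq //.
  apply: (leq_trans _ (_ : m + ones (take m t) <= _)); last by rewrite leq_add2l.
  by rewrite -(downs_take_revpath_leq l) -?eq_sz.
by apply: leq_trans lt_m; rewrite -(downs_revpath k) count_take_leq.
Qed.

(** As long as [m <= size s], the prefix has length at most [m] plus the ones among [m] bits, hence
    at most [2m]; once all D's are read, the bound on [i] suffices. *)
Lemma ballot_revpath k s i : i <= (size s).+1.*2 ->
  i <= (downs (take i (revpath k s))).*2.
Proof.
set m := downs _ => le_i; case: (leqP m (size s)) => [le_m|lt_m].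
  have := downs_take_revpath_leq k i le_m; rewrite leqnn => /esym le_i'.
  apply: (leq_trans le_i'); rewrite -addnn leq_add2l.
  by rewrite (leq_trans (count_size _ _)) // size_take; case: ltnP.
by rewrite (leq_trans le_i) // leq_double.
Qed.

Lemma sum_drise w :
  (\sum_(s <- w) drise s = (size w)%:Z - (downs w).*2%:Z)%R.
Proof.
elim: w => [|x w IH]; first by rewrite big_nil.
by rewrite big_cons IH; case: x => /=; lia.
Qed.

Lemma dheightE w i : i <= size w ->
  dheight w i = (i%:Z - (downs (take i w)).*2%:Z)%R.
Proof. by move=> le_i; rewrite /dheight sum_drise size_takel. Qed.

Lemma downs_take_rev w i : i <= size w ->
  (downs (take i w) + downs (take (size w - i) (rev w)) = downs w)%N.
Proof.
move=> le_i; rewrite take_rev subKn // count_rev -count_cat cat_take_drop //.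
Qed.

(** * Forbidden factors of reversed paths *)

(** A run of [p.+1] D's encloses [p] empty gaps, hence the shift by one. *)
Lemma prefix_nseq_revpath p k s :
  prefix (nseq p.+1 dD) (revpath k s) = prefix (nseq p false) s.
Proof.
elim: s p => [|b s IH] p; first by case: p k => [|p] [|k].
by case: b p => -[|p] //=; rewrite -?IH; case: (revpath k s).
Qed.

Lemma infix_nseq_revpath p k s : 0 < p ->
  infix (nseq p.+1 dD) (revpath k s) = infix (nseq p false) s.
Proof.
case: p => // p _; elim: s => [|b s IH].
  rewrite infixs0; apply: contraTF isT => /infixP[u [v /(congr1 (count_mem dD))]].
  by rewrite downs_revpath !count_cat count_nseq /=; lia.
rewrite infix_consl -IH.
(* Having at least two letters, the run of D's starts neither at a D followed by U nor at that U. *)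
case: b; rewrite [revpath _ _]/= infix_consl; first by rewrite infix_consl.
congr (_ || _).
exact: (prefix_nseq_revpath p.+1 k (false :: s)).
Qed.

(** [DUU] backwards is [UUD]: a U given by a bit stands between two D's, and no D follows the final
    run of U's. *)
Lemma avoids_UUD_revpath k s : avoids [:: dU; dU; dD] (revpath k s).
Proof.
rewrite /avoids; elim: s => [|b s IH].
  rewrite [revpath _ _]/= infix_consl; apply/negP => /orP[//|/infixP[u [v]]].
  move=> /(congr1 (count_mem dD)); rewrite !count_cat count_nseq /=; lia.
case: b; rewrite [revpath _ _]/= !infix_consl (negbTE IH) ?orbF //.
by case: s {IH} => [|[] s].
Qed.

Lemma avoids_UUD_nseq w : avoids [:: dU; dU; dD] [:: dU, dU & w] ->
  w = nseq (size w) dU.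
Proof.
elim: w => // -[] w IH; rewrite /avoids infix_consl negb_or => /andP[] //.
  by move=> _ av; rewrite {1}IH.
by case: w {IH}.
Qed.

(** Blocks [D] (bit 0) and [DU] (bit 1) are peeled off while another D follows; after [DUU] only U's
    can remain. *)
Lemma revpath_surj w : avoids [:: dU; dU; dD] (dD :: w) ->
  exists s k, dD :: w = revpath k s.
Proof.
have [m] := ubnP (size w); elim: m w => // m IH w.
rewrite ltnS => le_w av; have {}av: avoids [:: dU; dU; dD] w.
  by move: av; rewrite /avoids infix_consl negb_or => /andP[].
case: w le_w av => [|[] w] /=; first by exists [::], 0.
  case: w => [|[] w] le_w av; first by exists [::], 1.
    by exists [::], (size w).+2; rewrite {1}(avoids_UUD_nseq av).
  have [||s [k ->]] := IH w; last by exists (true :: s), k.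
    by rewrite ltnW.
  by move: av; rewrite /avoids infix_consl negb_or => /andP[].
move=> le_w av; have [||s [k ->]] := IH w => //; by exists (false :: s), k.
Qed.

(** * Dyck paths as bit words *)

(** The exponent balances the [(size w).+1] D's with as many U's; the subtraction never truncates,
    as [ones w <= size w]. *)
Definition bits_path (w : seq bool) := rev (revpath ((size w).+1 - ones w) w).

Lemma size_bits_path s : size (bits_path s) = (size s).+1.*2.
Proof.
by rewrite size_rev size_revpath; have := count_size id s; lia.
Qed.

Lemma downs_take_bits_path s i : i <= (size s).+1.*2 ->
  downs (take i (bits_path s)) +
    downs (take ((size s).+1.*2 - i) (revpath ((size s).+1 - ones s) s)) =
  (size s).+1.
Proof.
move=> le_i; have := @downs_take_rev (bits_path s) i.
by rewrite size_bits_path revK count_rev downs_revpath => ->.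
Qed.

Lemma is_dyck_bits_path n s : size s = n -> is_dyck n.+1 (bits_path s).
Proof.
move=> <-; have sz := size_bits_path s.
apply/and3P; split; first by rewrite sz.
  apply/forallP=> -[i /=]; rewrite ltnS => le_i; rewrite dheightE ?sz //.
  have := downs_take_bits_path le_i.
  have := @ballot_revpath ((size s).+1 - ones s) s _ (leq_subr i (size s).+1.*2).
  by lia.
rewrite dheightE ?sz //; have := downs_take_bits_path (leqnn (size s).+1.*2).
by rewrite subnn take0 /=; lia.
Qed.

Lemma bits_pathP n (P : dyck n.+1) : avoids [:: dD; dU; dU] P ->
  exists s : n.-tuple bool, val (val P) = bits_path s :> seq dstep.
Proof.
case: P => -[w /= sz_w] dyckP; rewrite /avoids -infix_rev => av.
have /and3P[sz /forallP ge0 /eqP h0] := dyckP.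
have {}sz := eqP sz.
have dw : downs w = n.+1.
  by move: h0; rewrite dheightE ?sz // take_oversize ?sz //; lia.
have [s [k E]] : exists s k, rev w = revpath k s.
  (* The path ends with D: before a final U its height would be -1. *)
  case: (lastP w) sz dw av ge0 => [//|u x]; rewrite size_rcons rev_rcons => sz dw av ge0.
  case: x dw av ge0 => dw av ge0; last exact: revpath_surj.
  have lt_u : size u < n.+1.*2.+1 by lia.
  have := ge0 (Ordinal lt_u); rewrite /= dheightE ?size_rcons //.
  move: dw; rewrite -cats1 take_cat ltnn subnn take0 cats0 count_cat /=; lia.
have sz_s : size s = n.
  by have := downs_revpath k s; rewrite -E count_rev dw => -[].
have k_def : k = (size s).+1 - ones s.
  have := size_revpath k s; rewrite -E size_rev sz sz_s; lia.
have sz_s' : size s == n by apply/eqP.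
by exists (Tuple sz_s'); rewrite /bits_path /= -k_def -E revK.
Qed.

Lemma is_fdyck_bits_path p n (P : dyck n.+1) s : 0 < p ->
  val (val P) = bits_path s :> seq dstep ->
  is_fdyck p P = avoids (nseq p false) s.
Proof.
move=> p_gt0 E; rewrite /is_fdyck /avoids E /bits_path.
rewrite -infix_rev revK -(infix_rev (nseq _ _)) revK.
have -> : rev (nseq p.+1 dD) = nseq p.+1 dD.
  by apply: (@eq_from_nth _ dD) => [|i]; rewrite size_rev // size_nseq => lt_i;
    rewrite nth_rev size_nseq // !nth_nseq !if_same.
by rewrite infix_nseq_revpath // [~~ _](avoids_UUD_revpath _ s).
Qed.

(** * Dominance and the Stanley order *)

Definition dominates (s t : seq bool) :=
  [forall j : 'I_(size s).+1, ones (take j t) <= ones (take j s)].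

Lemma dominatesP s t : size s = size t ->
  reflect (forall j, ones (take j t) <= ones (take j s)) (dominates s t).
Proof.
move=> sz; apply: (iffP forallP) => [dom j|dom j //].
have := dom (inord (minn j (size s))); rewrite inordK ?ltnS ?geq_minr //.
case: (leqP j (size s)) => // lt_j.
by rewrite {1}sz !take_size !take_oversize // -?sz ltnW.
Qed.

Lemma dominates_anti s t : size s = size t ->
  dominates s t -> dominates t s -> s = t.
Proof.
move=> sz /(dominatesP sz) st /(dominatesP (esym sz)) ts.
have E j : ones (take j s) = ones (take j t) by apply/eqP; rewrite eqn_leq ts st.
(* The prefixes of lengths [i] and [i.+1] isolate bit [i]. *)
apply: (@eq_from_nth _ false) => // i lt_i; have := E i.+1.
rewrite !(take_nth false) -?sz // -!cats1 !count_cat E => /addnI /=.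
by case: (nth _ s i); case: (nth _ t i).
Qed.

(** The total number of D's being fixed, a lower path has fewer D's left after each abscissa, that
    is, fewer in the matching prefix of its reversal. *)
Lemma stanley_le_bits_path n (P Q : dyck n.+1) s t :
  size s = n -> size t = n ->
  val (val P) = bits_path s :> seq dstep -> val (val Q) = bits_path t :> seq dstep ->
  stanley_le P Q = dominates s t.
Proof.
move=> sz_s sz_t EP EQ; have sz : size s = size t by rewrite sz_t.
have leE i : i <= n.+1.*2 -> (dheight P i <= dheight Q i)%R =
    (downs (take (n.+1.*2 - i) (revpath (n.+1 - ones s) s)) <=
     downs (take (n.+1.*2 - i) (revpath (n.+1 - ones t) t))).
  move=> le_i; rewrite !dheightE ?size_tuple // EP EQ.
  have := @downs_take_bits_path s i; have := @downs_take_bits_path t i.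
  by rewrite sz_s sz_t; lia.
apply/forallP/(dominatesP sz) => [le_PQ|dom [i /= lt_i]]; last first.
  rewrite leE //.
  by move/(dominance_revpath (n.+1 - ones s) (n.+1 - ones t) sz): dom => ->.
apply/(dominance_revpath (n.+1 - ones s) (n.+1 - ones t) sz) => i.
wlog le_i : i / i <= n.+1.*2 => [IH|].
  case: (leqP i n.+1.*2) => [/IH //|lt_i].
  have := IH _ (leqnn _); rewrite !(@take_oversize _ n.+1.*2) ?(@take_oversize _ i) //;
  by rewrite size_revpath; have := count_size id s; have := count_size id t; lia.
have lt_i : n.+1.*2 - i < n.+1.*2.+1 by rewrite ltnS leq_subr.
by have := le_PQ (Ordinal lt_i); rewrite leE ?leq_subr //= subKn.
Qed.

(** * Motzkin steps as pairs of bits *)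

(** These bits form the dominating word, which belongs to the lower end of the interval. *)
Definition upper_bit (x : mstep) := if x is mU then true else x == mF1.
Definition lower_bit (x : mstep) := if x is mD then true else x == mF1.

Definition mstep_of_bits (b : bool * bool) : mstep :=
  match b with
  | (true, true) => mF1
  | (true, false) => mU
  | (false, true) => mD
  | (false, false) => mF2
  end.

(** A factor of the image comes from the factor of [w] at the same place; a whole family of patterns
    thus becomes one constant bit pattern. *)
Lemma infix_nseq_map (S : eqType) (T : eqType) (f : S -> T) (p : nat) (b : T) (w : seq S) :
  reflect (exists a : p.-tuple S, all (fun x => f x == b) a /\ infix a w)
          (infix (nseq p b) (map f w)).
Proof.
apply: (iffP idP) => [/infixP[u [v E]]|[a [fa /infixP[u [v ->]]]]]; last first.
  rewrite !map_cat; apply/infixP; exists (map f u), (map f v); congr (_ ++ (_ ++ _)).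
  have /all_pred1P-> : all (pred1 b) (map f a) by rewrite all_map.
  by rewrite size_map size_tuple.
have sz : size (take p (drop (size u) w)) == p.
  have := congr1 size E; rewrite size_map !size_cat size_nseq => szw.
  by rewrite size_takel // size_drop szw; lia.
exists (Tuple sz); split.
  rewrite -[all _ _](all_map f (pred1 b)) /= map_take map_drop E drop_size_cat //.
  by rewrite take_size_cat ?size_nseq // all_pred1_nseq.
apply/infixP; exists (take (size u) w), (drop p (drop (size u) w)).
by rewrite !cat_take_drop.
Qed.

(** F2 and U are the letters with lower bit 0, F2 and D those with upper bit 0. *)
Lemma mpatternsP p w :
  [forall a in mpatterns p, avoids (tval a) w] =
  avoids (nseq p false) (map upper_bit w) && avoids (nseq p false) (map lower_bit w).
Proof.
have memE x : (x \in [:: mF2; mU]) = (lower_bit x == false) /\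
              (x \in [:: mF2; mD]) = (upper_bit x == false) by case: x.
apply/forall_inP/andP => [av|[avu avl] a].
  split; apply/negP => /infix_nseq_map[a [alla]]; apply/negP; apply: av;
    rewrite inE !inE; apply/orP; [right|left]; apply: sub_all alla => x /=.
    by rewrite -(memE x).2.
  by rewrite -(memE x).1.
rewrite !inE => /orP[] alla; apply/negP => inf.
  case/negP: avl; apply/infix_nseq_map; exists a; split=> //.
  by apply: sub_all alla => x /=; rewrite -(memE x).1.
case/negP: avu; apply/infix_nseq_map; exists a; split=> //.
by apply: sub_all alla => x /=; rewrite -(memE x).2.
Qed.

Lemma sum_mrise w : (\sum_(x <- w) mrise x =
  (ones (map upper_bit w))%:Z - (ones (map lower_bit w))%:Z)%R.
Proof.
elim: w => [|x w IH]; first by rewrite big_nil.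
by rewrite big_cons IH; case: x => /=; lia.
Qed.

(** A step rises by its upper bit minus its lower bit, so heights are differences of prefix
    counts. *)
Lemma is_motzkin_dominates m w : size w = m ->
  is_motzkin m w = dominates (map upper_bit w) (map lower_bit w).
Proof.
move=> sz; rewrite /is_motzkin sz eqxx /dominates size_map sz.
by apply: eq_forallb => i; rewrite /mheight sum_mrise !map_take; lia.
Qed.

(** * Counting intervals *)

(** Each interval contains its own endpoints, so each pair of endpoints bounds the other; intervals
    can then be counted as comparable pairs. *)
Lemma poset_itv_inj d (T : finPOrderType d) (P Q P' Q' : T) :
  (P <= Q)%O -> (P' <= Q')%O -> poset_itv P Q = poset_itv P' Q' -> (P, Q) = (P', Q').
Proof.
move=> le1 le2 E.
have: P \in poset_itv P' Q' by rewrite -E inE lexx.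
have: Q \in poset_itv P' Q' by rewrite -E inE lexx andbT.
have: P' \in poset_itv P Q by rewrite E inE lexx.
have: Q' \in poset_itv P Q by rewrite E inE lexx andbT.
rewrite !inE => /andP[_ b1] /andP[a1 _] /andP[_ b2] /andP[a2 _].
by congr (_, _); apply: le_anti; rewrite ?a1 ?a2 ?b1 ?b2.
Qed.

Lemma card_intervals d (T : finPOrderType d) :
  #|intervals T| = #|[set PQ : T * T | (PQ.1 <= PQ.2)%O]|.
Proof.
rewrite -(@card_in_imset _ _ (fun PQ : T * T => poset_itv PQ.1 PQ.2)).
  apply: eq_card => I; rewrite inE; apply/existsP/imsetP.
    by move=> [P /existsP[Q /andP[le_PQ /eqP->]]]; exists (P, Q); rewrite ?inE.
  by move=> [[P Q]]; rewrite inE /= => le_PQ ->; exists P; apply/existsP; exists Q;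
    rewrite le_PQ /=.
by move=> [P Q] [P' Q']; rewrite !inE /=; apply: poset_itv_inj.
Qed.

Lemma card_eq_bij (S T : finType) : #|S| = #|T| -> exists f : S -> T, bijective f.
Proof.
move=> E; exists (fun x => enum_val (cast_ord E (enum_rank x))).
exists (fun y => enum_val (cast_ord (esym E) (enum_rank y))) => x;
  by rewrite enum_valK ?cast_ordK ?cast_ordKV enum_rankK.
Qed.

Lemma fdyck_bits p n : 0 < p ->
  exists bits : fdyck p n.+1 -> n.-tuple bool,
    [/\ injective bits,
        forall s : n.-tuple bool,
          avoids (nseq p false) s <-> exists P, bits P = s
      & forall P Q, (P <= Q)%O = dominates (bits P) (bits Q)].
Proof.
move=> p_gt0.
have bits_ex (P : fdyck p n.+1) :
    exists s : n.-tuple bool, val (val (val P)) == bits_path s :> seq dstep.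
  have := valP P; rewrite /is_fdyck => /andP[/bits_pathP[s E] _].
  by exists s; apply/eqP.
pose bits P := xchoose (bits_ex P).
have bitsE P : val (val (val P)) = bits_path (bits P) :> seq dstep.
  exact/eqP/(xchooseP (bits_ex P)).
have leE P Q : (P <= Q)%O = dominates (bits P) (bits Q).
  by apply: stanley_le_bits_path; rewrite ?size_tuple.
exists bits; split=> // [P Q E|s].
  by do 3!apply: val_inj; rewrite !bitsE E.
split=> [av|[P <-]]; last first.
  by rewrite -(is_fdyck_bits_path p_gt0 (bitsE P)) (valP P).
have dyckP := is_dyck_bits_path (size_tuple s).
have szP : size (bits_path s) == n.+1.*2 by rewrite size_bits_path size_tuple.
pose P := @Dyck n.+1 (Tuple szP) dyckP.
have fP : is_fdyck p P by rewrite (@is_fdyck_bits_path p n P s).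
exists (FDyck fP); apply: val_inj.
have EP : val (val P) = bits_path s :> seq dstep by [].
(* [s] and the chosen bits encode the same path, so by reflexivity of the Stanley order each
   dominates the other. *)
by apply: dominates_anti; rewrite ?size_tuple //;
  rewrite -(stanley_le_bits_path (P := P) (Q := P)) ?size_tuple ?stanley_le_refl //;
  exact: bitsE (FDyck fP).
Qed.

Theorem theorem4p8 (p n : nat) (hp : (3 <= p)%N) (hn : (1 <= n)%N) :
  exists f : {I : {set fdyck p n} | I \in intervals (fdyck p n)} ->
             {w : (n.-1).-tuple mstep | w \in avoiding_motzkin p n.-1},
    bijective f.
Proof.
(* Both types are finite, so equal cardinals suffice. *)
case: n hn => // n _; apply: card_eq_bij; rewrite !card_sig.
have p_gt0 : 0 < p by apply: leq_trans hp.
have [bits [bits_inj bitsP le_bits]] := fdyck_bits n p_gt0.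
(* Both sides inject onto this set of pairs: [h] from comparable paths, [g] from Motzkin words. *)
pose B := [set st : n.-tuple bool * n.-tuple bool |
  [&& dominates st.1 st.2, avoids (nseq p false) st.1 & avoids (nseq p false) st.2]].
transitivity #|B|; last first.
  pose g (w : n.-tuple mstep) := ([tuple of map upper_bit w], [tuple of map lower_bit w]).
  have g_inj : injective g.
    move=> v w [Eu El]; apply/eq_from_tnth => i.
    have := congr1 (fun s => nth false s i) Eu; have := congr1 (fun s => nth false s i) El.
    rewrite !(nth_map mF1) ?size_tuple // -!tnth_nth.
    by case: (tnth v i); case: (tnth w i).
  rewrite -(card_imset (mem (avoiding_motzkin p n)) g_inj).
  apply: eq_card => -[s t]; rewrite inE; apply/idP/imsetP => /=.
    (* Superposing [s] and [t] letter by letter gives the preimage under [g]. *)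
    have [w [-> ->]] : exists w, (s, t) = g w.
      exists [tuple mstep_of_bits (tnth s i, tnth t i) | i < n].
      congr (_, _); apply/eq_from_tnth => i; rewrite !tnth_map tnth_ord_tuple;
      by case: (tnth s i); case: (tnth t i).
    move=> dom; exists w => //.
    by rewrite inE mpatternsP is_motzkin_dominates ?size_tuple.
  by move=> [w]; rewrite inE mpatternsP is_motzkin_dominates ?size_tuple // => mw [-> ->].
rewrite card_intervals; pose h (PQ : fdyck p n.+1 * fdyck p n.+1) := (bits PQ.1, bits PQ.2).
have h_inj : injective h by move=> [P Q] [P' Q'] [/bits_inj-> /bits_inj->].
rewrite -(card_imset _ h_inj); apply: eq_card => -[s t]; rewrite [RHS]inE; apply/imsetP/idP.
  move=> [[P Q]]; rewrite inE /= le_bits => dom [-> ->]; rewrite /= dom.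
  by apply/and3P; split=> //; apply/bitsP; [exists P | exists Q].
move=> /and3P[/= dom /bitsP[P EP] /bitsP[Q EQ]].
by exists (P, Q); rewrite /h /= ?EP ?EQ // inE /= le_bits EP EQ.
Qed.
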